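(* Let $G=(V,E)$ be a finite simple undirected graph that admits a strongly connected orientation. Run the algorithm SC-PATH-REVERSAL on $G$: start from an arbitrary strongly connected orientation of $G$, and, as long as the current orientation contains a strongly reversible directed path, reverse (the direction of every arc of) such a path. Then the orientation $\Lambda$ output by the algorithm (a strongly connected orientation containing no strongly reversible directed path) minimizes the lexicographic order of the indegree sequence among all strongly connected orientations of $G$; that is, no strongly connected orientation of $G$ has an indegree sequence that is lexicographically smaller than that of $\Lambda$.
   Context: An orientation of $G$ assigns to each edge a direction, giving a digraph $D=(V,\Lambda)$; it is strongly connected if the resulting digraph is strongly connected. The indegree $d^-_\Lambda(v)$ of $v$ is the number of arcs directed into $v$. The indegree sequence of an orientation is the list of the indegrees of all vertices arranged in non-increasing order. For two such sequences $s=(s_1,\dots,s_n)$ and $t=(t_1,\dots,t_n)$, $s$ is lexicographically smaller than $t$ if there is $k$ with $s_k<t_k$ and $s_i=t_i$ for all $i<k$. In a digraph, a vertex $u$ two-reaches $v$ if there are two arc-disjoint directed paths from $u$ to $v$ (by convention every vertex two-reaches itself). A directed path from $u$ to $v$ is strongly reversible if $d^-(u)<d^-(v)-1$ and $u$ two-reaches $v$. *)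

(* Defs.v *)
From mathcomp Require Import all_boot.
From Stdlib Require Export Relation_Operators.

Set Implicit Arguments.
Unset Strict Implicit.
Unset Printing Implicit Defensive.

Section Orientations.

Variable V : finType.

(* A simple graph on V is a symmetric irreflexive e : rel V; a digraph on V is
   its set of arcs L : {set V * V}, the arc (x, y) being directed into y. *)
Implicit Types (e : rel V) (L : {set V * V}) (u v : V) (p q : seq V).

Definition is_orientation e L : Prop :=
  (forall x y, (x, y) \in L -> e x y) /\
  (forall x y, e x y -> ((x, y) \in L) (+) ((y, x) \in L)).

Definition strongly_connected L : Prop :=
  forall x y, connect [rel a b | (a, b) \in L] x y.

Definition sc_orientation e L : Prop :=
  is_orientation e L /\ strongly_connected L.

Definition indegree L v : nat := #|[set x | (x, v) \in L]|.

Definition indegree_seq L : seq nat :=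
  sort geq [seq indegree L v | v <- enum V].

(* The vertices of the path are u :: p, without repetition. *)
Definition dipath L u v p : Prop :=
  [/\ path [rel a b | (a, b) \in L] u p, last u p = v & uniq (u :: p)].

Definition path_arcs u p : seq (V * V) := pairmap pair u p.

Definition two_reaches L u v : Prop :=
  u = v \/
  exists p q, [/\ dipath L u v p, dipath L u v q &
                  ~~ has [in path_arcs u p] (path_arcs u q)].

(* The truncation of the subtraction is harmless: both readings are false when
   indegree L v = 0. *)
Definition strongly_reversible L u v p : Prop :=
  [/\ dipath L u v p, indegree L u < indegree L v - 1 & two_reaches L u v].

Definition reverse_path L u p : {set V * V} :=
  (L :\: [set a in path_arcs u p]) :|:
  [set a in [seq (a.2, a.1) | a <- path_arcs u p]].

Definition reversal_step L L' : Prop :=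
  exists u v p, strongly_reversible L u v p /\ L' = reverse_path L u p.

(* L is the result of a complete run, for some choice of the initial
   orientation and of the path reversed at each step. *)
Definition sc_path_reversal_output e L : Prop :=
  exists L0,
    [/\ sc_orientation e L0,
        clos_refl_trans _ reversal_step L0 L &
        ~ exists u v p, strongly_reversible L u v p].

End Orientations.

Definition lex_smaller (s t : seq nat) : Prop :=
  exists k, [/\ k < size s, k < size t, nth 0 s k < nth 0 t k &
                forall i, i < k -> nth 0 s i = nth 0 t i].

(* Main.v *)
(** Let [d], [d'] be the indegree functions of the output and of another strongly
    connected orientation. A set entered by a single arc of the output is tight:
    it minimizes the total indegree among all strongly connected orientations.
    Given [k], let [X] be the set of vertices that two-reach a vertex of indegree
    above [k]. As no path is strongly reversible, [d >= k] on [X], and [d <= k]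
    off [X]. By Menger, tight sets separate each vertex of [X] from each vertex
    outside; since tight sets form a crossing family, uncrossing gives
    [d(X) <= d'(X)]. Hence [sum (d - k)^+ <= sum (d' - k)^+] for every [k], that
    is, [d] is majorized by [d'], and a fortiori lexicographically minimal. *)

Require Import Defs.
From mathcomp Require Import all_boot all_order all_algebra zify.

Set Implicit Arguments.
Unset Strict Implicit.
Unset Printing Implicit Defensive.

Import Order.TTheory GRing.Theory Num.Theory.

(** * Directed cuts, connectivity and paths *)

Section Cuts.

Variable V : finType.
Implicit Types (L M : {set V * V}) (Z : {set V}) (u v : V) (p : seq V).

Definition enters Z (a : V * V) : bool := (a.1 \notin Z) && (a.2 \in Z).

Definition incut L Z : nat := \sum_(a in L) enters Z a.

Lemma incut_gt0P L Z :
  reflect (exists2 a, a \in L & enters Z a) (0 < incut L Z).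
Proof.
rewrite /incut lt0n sum_nat_eq0 negb_forall; apply: (iffP existsP).
  by case=> a; rewrite negb_imply eqb0 negbK => /andP[aL aZ]; exists a.
by case=> a aL aZ; exists a; rewrite negb_imply aL aZ.
Qed.

Lemma incut_ge2 L Z a b :
  a \in L -> b \in L -> a != b -> enters Z a -> enters Z b -> 1 < incut L Z.
Proof.
move=> aL bL ab aZ bZ; rewrite /incut (bigD1 a) //= (bigD1 b) /= ?bL 1?eq_sym //.
by rewrite aZ bZ.
Qed.

Lemma incut_setD L M Z : incut L Z <= incut (L :\: M) Z + incut M Z.
Proof.
rewrite /incut (big_setID M) /= addnC leq_add2l setIC.
rewrite [leqRHS](big_setID L) /=; exact: leq_addr.
Qed.

Lemma incut_submod L Z1 Z2 :
  incut L (Z1 :&: Z2) + incut L (Z1 :|: Z2) <= incut L Z1 + incut L Z2.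
Proof.
rewrite /incut -!big_split /=; apply: leq_sum => -[x y] _; rewrite /enters !inE /=.
by do 4!case: (_ \in _).
Qed.

Lemma connect_incut L x y :
  reflect (forall Z, x \notin Z -> y \in Z -> 0 < incut L Z)
          (connect [rel a b | (a, b) \in L] x y).
Proof.
apply: (iffP idP) => [/connectP[p + ->] Z | cuts].
  elim: p x => [|z p IHp] x /=; first by move=> _ /negPf ->.
  case/andP=> xz zp xZ yZ; have [zZ | zZ] := boolP (z \in Z); last exact: IHp zp _ _.
  by apply/incut_gt0P; exists (x, z); rewrite // /enters xZ zZ.
apply/negPn/negP => nxy.
pose Z := [set z | ~~ connect [rel a b | (a, b) \in L] x z].
have /cuts : x \notin Z by rewrite inE connect0.
rewrite inE => /(_ nxy)/incut_gt0P[[a b] abL /andP[/=]].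
rewrite !inE negbK => xa /negP[]; apply: connect_trans xa _.
exact: connect1.
Qed.

Lemma strongly_connectedP L :
  strongly_connected L <->
  forall Z, Z != set0 -> Z != setT -> 0 < incut L Z.
Proof.
split=> [scL Z /set0Pn[y yZ] | cuts x y].
  rewrite -subTset => /subsetPn[x _ xZ]; exact/(connect_incut _ _ _ (scL x y)).
apply/connect_incut => Z xZ yZ; apply: cuts; first by apply/set0Pn; exists y.
by rewrite -subTset; apply/subsetPn; exists x; rewrite ?inE.
Qed.

Lemma connect_dipath L x y :
  connect [rel a b | (a, b) \in L] x y -> exists p, dipath L x y p.
Proof.
case/connectP=> p pP ->; case/shortenP: pP => q qP uq _; by exists q.
Qed.

Lemma mem_path_arcs L u p :
  path [rel a b | (a, b) \in L] u p = all [in L] (path_arcs u p).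
Proof. by elim: p u => //= v p IHp u; rewrite IHp. Qed.

Lemma dipath_sub L u v p : dipath L u v p -> {subset path_arcs u p <= L}.
Proof. by case; rewrite mem_path_arcs => /allP. Qed.

Lemma uniq_path_arcs u p : uniq (u :: p) -> uniq (path_arcs u p).
Proof.
have E w : map snd (path_arcs w p) = p by elim: p w => //= v p IHp w; rewrite IHp.
by case/andP=> _; rewrite -{1}(E u) => /map_uniq.
Qed.

Definition swap (a : V * V) : V * V := (a.2, a.1).

Lemma swapK : involutive swap. Proof. by case. Qed.

(** A walk crosses the boundary of [Z] alternately inward and outward, so the two counts differ only
    through its endpoints; [swap a] enters [Z] exactly when [a] leaves it. *)
Lemma path_arcs_enters Z u p :
  \sum_(a <- path_arcs u p) enters Z a + (u \in Z) =
  \sum_(a <- path_arcs u p) enters Z (swap a) + (last u p \in Z).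
Proof.
elim: p u => [|v p IHp] u /=; first by rewrite !big_nil.
rewrite !big_cons /enters /=; have := IHp v; rewrite /enters /=.
by case: (u \in Z); case: (v \in Z) => /=; lia.
Qed.

Lemma dipath_enters Z L u v p :
  dipath L u v p -> u \notin Z -> v \in Z -> exists2 a, a \in path_arcs u p & enters Z a.
Proof.
case=> _ <- _; elim: p u => [|w p IHp] u /= uZ vZ; first by rewrite vZ in uZ.
have [wZ | wZ] := boolP (w \in Z).
  by exists (u, w); rewrite ?inE ?eqxx // /enters uZ wZ.
by case: (IHp w wZ vZ) => a ap aZ; exists a; rewrite ?inE ?ap ?orbT.
Qed.

Lemma two_reaches_incut L u v Z :
  two_reaches L u v -> u \notin Z -> v \in Z -> 1 < incut L Z.
Proof.
case=> [-> /negPf -> // | [p [q [Lp Lq /hasPn pq]]] uZ vZ].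
have [a ap aZ] := dipath_enters Lp uZ vZ; have [b bq bZ] := dipath_enters Lq uZ vZ.
apply: incut_ge2 (dipath_sub Lp ap) (dipath_sub Lq bq) _ aZ bZ.
by apply/eqP => ab; have := pq b bq; rewrite -ab /= ap.
Qed.

(** * Path reversal in orientations, Menger's theorem for two paths, indegree sums *)

Section Orientation.

Variable e : rel V.
Hypothesis e_sym : symmetric e.

Lemma orientation_swap L a : is_orientation e L -> a \in L -> swap a \notin L.
Proof.
by case=> Le Lx; case: a => x y xyL; have := Lx x y (Le _ _ xyL); rewrite xyL.
Qed.

Lemma in_reverse_path L u p a :
  (a \in reverse_path L u p) =
  (a \in L) && (a \notin path_arcs u p) || (swap a \in path_arcs u p).
Proof.
rewrite /reverse_path !inE andbC; congr (_ || _).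
by rewrite -{1}(swapK a) (mem_map (inv_inj swapK)).
Qed.

Lemma reverse_path_orientation L u v p :
  is_orientation e L -> dipath L u v p -> is_orientation e (reverse_path L u p).
Proof.
move=> oL Lp; have sub := dipath_sub Lp; case: (oL) => Le Lx; split=> x y.
  rewrite in_reverse_path => /orP[/andP[/Le//] | /sub/Le]; by rewrite e_sym.
move=> /Lx; rewrite !in_reverse_path /swap /=.
have := sub (x, y); have := sub (y, x).
do 2!case: (_ \in path_arcs u p); case: ((x, y) \in L); case: ((y, x) \in L) => //=;
  by [move=> _ /(_ isT) | move=> /(_ isT)].
Qed.

Lemma incut_reverse_path L u v p Z :
  is_orientation e L -> dipath L u v p ->
  incut (reverse_path L u p) Z + (v \in Z) = incut L Z + (u \in Z).
Proof.
move=> oL Lp; have sub := dipath_sub Lp; case: (Lp) => _ lp /uniq_path_arcs up.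
have := path_arcs_enters Z u p; rewrite lp.
pose P := [set a in path_arcs u p]; pose Q := [set a in map swap (path_arcs u p)].
have sP (f : V * V -> nat) : \sum_(a in P) f a = \sum_(a <- path_arcs u p) f a.
  by rewrite big_uniq //; apply: eq_bigl => a; rewrite inE.
have sQ : \sum_(a in Q) enters Z a = \sum_(a <- path_arcs u p) enters Z (swap a).
  rewrite -(big_map swap xpredT (fun a => nat_of_bool (enters Z a))).
  rewrite big_uniq /= ?(map_inj_uniq (inv_inj swapK)) //.
  by apply: eq_bigl => a; rewrite inE.
have -> : incut (reverse_path L u p) Z =
    \sum_(a in L :\: P) enters Z a + \sum_(a in Q) enters Z a.
  rewrite /incut -bigU /=; first by apply: eq_bigl => a; rewrite !inE.
  (* The reversed arcs are new, since an orientation has no two opposite arcs. *)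
  rewrite disjoint_sym disjoints_subset.
  apply/subsetP => a; rewrite !inE => /mapP[b /sub bL ->].
  by rewrite (negPf (orientation_swap oL bL)) andbF.
have -> : incut L Z = \sum_(a in L :\: P) enters Z a + \sum_(a in P) enters Z a.
  rewrite /incut (big_setID P) addnC; congr (_ + _); apply: eq_bigl => a.
  by rewrite !inE; case ap: (_ \in path_arcs u p); rewrite ?andbF ?andbT // sub.
rewrite sP sQ; lia.
Qed.

(** Only a cut with [u] outside and [v] inside loses an entering arc, and it loses just one of the
    two or more that [two_reaches] guarantees. *)
Lemma reversal_step_sc L L' :
  sc_orientation e L -> reversal_step L L' -> sc_orientation e L'.
Proof.
case=> oL scL [u [v [p [[Lp _ uv] ->]]]].
split; first exact: reverse_path_orientation oL Lp.
apply/strongly_connectedP => Z Z0 ZT; have := incut_reverse_path Z oL Lp.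
have := (strongly_connectedP L).1 scL Z Z0 ZT; have := two_reaches_incut (Z := Z) uv.
by case: (u \in Z); case: (v \in Z) => //=; lia.
Qed.

(* Menger's theorem for two paths: augment twice along residual paths, which
   here are paths of the reversed orientations; [L :\: L2] then carries two
   units of flow from [u] to [v]. *)
Lemma two_reaches_of_incut L u v :
  is_orientation e L ->
  (forall Z, u \notin Z -> v \in Z -> 1 < incut L Z) -> two_reaches L u v.
Proof.
move=> oL cuts; right.
have reach M : (forall Z, u \notin Z -> v \in Z -> 0 < incut M Z) ->
    exists p, dipath M u v p.
  by move=> c; apply: connect_dipath; apply/connect_incut.
have step M p : is_orientation e M -> dipath M u v p ->
    is_orientation e (reverse_path M u p) /\
    forall Z, u \notin Z -> v \in Z -> (incut (reverse_path M u p) Z).+1 = incut M Z.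
  move=> oM Mp; split; first exact: reverse_path_orientation oM Mp.
  by move=> Z /negPf uZ vZ; have := incut_reverse_path Z oM Mp; rewrite uZ vZ; lia.
have [|p1 /(step L _ oL)[]] := reach L; first by move=> Z uZ vZ; have := cuts Z uZ vZ; lia.
set L1 := reverse_path L u p1 => oL1 c1.
have [|p2 /(step L1 _ oL1)[]] := reach L1.
  by move=> Z uZ vZ; have := cuts Z uZ vZ; have := c1 Z uZ vZ; lia.
set L2 := reverse_path L1 u p2 => oL2 c2.
(* A cut separating [u] from [v] has exactly two fewer entering arcs in [L2] than in [L], so at
   least two of its arcs lie in [L :\: L2]. One is used here; reversing [p] leaves one for [q]. *)
have [|p Dp] := reach (L :\: L2).
  move=> Z uZ vZ; have := incut_setD L L2 Z; have := c1 Z uZ vZ; have := c2 Z uZ vZ.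
  lia.
have sub := dipath_sub Dp.
have dipathW (M N : {set V * V}) w q : {subset path_arcs w q <= N} -> dipath M w v q -> dipath N w v q.
  by move=> sN [_ lq uq]; split=> //; rewrite mem_path_arcs; apply/allP.
have Lp : dipath L u v p.
  by apply: dipathW Dp => a /sub; rewrite inE => /andP[].
have [oL3 c3] := step L p oL Lp; set L3 := reverse_path L u p in oL3 c3.
have [|q Dq] := reach (L3 :\: L2).
  move=> Z uZ vZ; have := incut_setD L3 L2 Z.
  by have := c1 Z uZ vZ; have := c2 Z uZ vZ; have := c3 Z uZ vZ; lia.
(* An arc of [q] cannot be a reversed arc of [p]: its reverse would avoid [L2], so the orientation
   [L2] would contain the arc itself. *)
have subq a : a \in path_arcs u q -> (a \in L) && (a \notin path_arcs u p).
  move/(dipath_sub Dq); rewrite inE [a \in L3]in_reverse_path => /andP[aL2 /orP[//|/sub]].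
  rewrite inE => /andP[saL2 saL]; case: oL2 => _ /(_ a.2 a.1).
  case: oL => Le _; rewrite (Le _ _ saL) => /(_ isT).
  by rewrite (negPf saL2) -surjective_pairing (negPf aL2).
exists p, q; split=> //; first by apply: dipathW Dq => a /subq /andP[].
by apply/hasPn => a /subq /andP[].
Qed.

(** The arcs into vertices of [Z] are those inside [Z] and those of the cut. The double sum counts
    each inner edge twice, hence the doubling. It does not depend on [L], so comparing indegree sums
    of two orientations on [Z] amounts to comparing their cuts. *)
Lemma sum_indegree L Z :
  is_orientation e L ->
  (\sum_(v in Z) indegree L v).*2 =
  \sum_(x in Z) \sum_(y in Z) e x y + (incut L Z).*2.
Proof.
move=> oL; case: (oL) => Le Lx.
have dE v : indegree L v = \sum_x ((x, v) \in L).
  by rewrite /indegree -sum1dep_card big_mkcond; apply: eq_bigr => x _; case: ifP.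
have cE : incut L Z = \sum_(v in Z) \sum_(x in ~: Z) ((x, v) \in L).
  rewrite exchange_big pair_big /= /incut big_mkcond [RHS]big_mkcond.
  apply: eq_bigr => -[x v] _; rewrite /enters /= !inE.
  by case: (_ \in L); case: (_ \in Z); case: (_ \in Z).
have iE : \sum_(x in Z) \sum_(y in Z) e x y =
    (\sum_(v in Z) \sum_(x in Z) ((x, v) \in L)).*2.
  rewrite -addnn [X in _ = _ + X]exchange_big /= -big_split; apply: eq_bigr => x _.
  rewrite -big_split; apply: eq_bigr => y _ /=.
  case exy: (e x y); first by have := Lx x y exy; do 2!case: (_ \in L).
  by rewrite !(contraFF (Le _ _)) // e_sym.
rewrite iE cE -doubleD -big_split; congr (_.*2); apply: eq_bigr => v _.
rewrite dE (bigID [in Z]) /=; congr (_ + _); apply: eq_bigl => x.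
by rewrite inE.
Qed.

End Orientation.

End Cuts.

(** * Uncrossing of set families *)

Section Uncrossing.

Variable V : finType.
Implicit Types (A B Z X : {set V}) (P : {set {set V}}).
Local Open Scope ring_scope.

(** Among the subfamilies with the same cover, one of minimal weight [w] is disjoint: if two members
    met, replacing both by their union, or one by its difference with the other, would keep the
    cover and lower the weight. Over a disjoint family the sums simply add up. *)
Lemma cover_le0 (x : V -> int) P :
  (forall A, A \in P -> \sum_(v in A) x v <= 0) ->
  (forall A B, A \in P -> B \in P -> ~~ [disjoint A & B] ->
     [|| A :|: B \in P, A :\: B \in P | B :\: A \in P]) ->
  \sum_(v in cover P) x v <= 0.
Proof.
move=> P_le0 P_uncross.
pose w (Q : {set {set V}}) := (\sum_(A in Q) #|A|.+1)%N.
have [Q /andP[QP /eqP Qcov] Qmin] :=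
  @arg_minnP _ P (fun Q : {set {set V}} => (Q \subset P) && (cover Q == cover P)) w
    (introT andP (conj (subxx P) (eqxx _))).
suff tQ : trivIset Q.
  rewrite -Qcov (big_trivIset _ tQ) /=; apply: sumr_le0 => A AQ.
  exact: P_le0 (subsetP QP A AQ).
have Qmin' C (S : {set {set V}}) : C \in P -> S \subset Q -> C :|: cover S = cover Q ->
    (w Q <= #|C|.+1 + w S)%N.
  move=> CP SQ covE; have /Qmin : (C |: S \subset P) && (cover (C |: S) == cover P).
    rewrite subUset sub1set CP (subset_trans SQ QP) /=.
    by rewrite -Qcov -covE /cover bigcup_setU big_set1.
  move/leq_trans; apply; have [CS | CS] := boolP (C \in S).
    by rewrite (setUidPr _) ?sub1set // leq_addl.
  by rewrite /w big_setU1.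
have wD A (S : {set {set V}}) : A \in S -> w S = (#|A|.+1 + w (S :\ A))%N.
  by move=> AS; rewrite /w (big_setD1 A AS).
have covD A (S : {set {set V}}) : A \in S -> cover S = A :|: cover (S :\ A).
  by move=> AS; rewrite /cover (big_setD1 A AS).
have diff A B : A \in Q -> B \in Q -> A != B -> ~~ [disjoint A & B] -> A :\: B \notin P.
  move=> AQ BQ AB; rewrite -setI_eq0 -card_gt0 => nd; apply/negP => ABP.
  have BQA : B \in Q :\ A by rewrite !inE eq_sym AB.
  have covE : A :\: B :|: cover (Q :\ A) = cover Q.
    rewrite (covD A Q AQ) (covD B _ BQA) !setUA; congr (_ :|: _).
    by apply/setP => z; rewrite !inE; do 2!case: (z \in _).
  have := Qmin' _ _ ABP (subD1set _ _) covE; rewrite (wD A Q AQ) leq_add2r.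
  by have := cardsID B A; lia.
apply/trivIsetP => A B AQ BQ AB; apply: contraT => nd.
have /or3P[] := P_uncross A B (subsetP QP A AQ) (subsetP QP B BQ) nd; last first.
- by rewrite (negPf (diff B A _ _ _ _)) // 1?eq_sym // disjoint_sym.
- by rewrite (negPf (diff A B _ _ _ _)).
move=> ABP; have BQA : B \in Q :\ A by rewrite !inE eq_sym AB.
have := Qmin' _ (Q :\ A :\ B) ABP.
rewrite (wD A Q AQ) (wD B _ BQA) (covD A Q AQ) (covD B _ BQA) setUA => /(_ _ erefl).
rewrite (subset_trans (subD1set _ _) (subD1set _ _)) => /(_ isT).
by rewrite addnA leq_add2r; have := cardsUI A B; lia.
Qed.

(* An exchange argument as in M-convexity: while [x v < 0] for some [v], the
   sets that forbid moving one unit from [u] to [v] uncross, hence cannot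
   contain every [u] with [x u > 0]. *)
Lemma crossing_family_ge0 (F : {set {set V}}) (x : V -> int) X :
  (forall Z1 Z2, Z1 \in F -> Z2 \in F -> Z1 :&: Z2 != set0 -> Z1 :|: Z2 != setT ->
     (Z1 :&: Z2 \in F) && (Z1 :|: Z2 \in F)) ->
  (forall u v, u \notin X -> v \in X ->
     exists2 Z, Z \in F & (u \notin Z) && (v \in Z)) ->
  \sum_v x v = 0 -> (forall Z, Z \in F -> 0 <= \sum_(v in Z) x v) ->
  0 <= \sum_(v in X) x v.
Proof.
move=> F_cross X_sep.
(* Induction on the l1 norm of [x], which a move from a positive to a negative value decreases. *)
have [n] := ubnP (\sum_v `|x v|)%N; elim: n x => // n IHn x xn xV xF.
have sumC Z : \sum_(v in ~: Z) x v = - \sum_(v in Z) x v.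
  move: xV; rewrite (bigID [in Z]) /= => /eqP; rewrite addrC addr_eq0 => /eqP <-.
  by apply: eq_bigl => v; rewrite inE.
have sumUI A B : \sum_(v in A :&: B) x v + \sum_(v in A :|: B) x v =
    \sum_(v in A) x v + \sum_(v in B) x v.
  rewrite !(big_mkcond [in _]) -!big_split; apply: eq_bigr => v _ /=.
  by rewrite !inE; do 2!case: (_ \in _); rewrite ?addr0 ?add0r.
have [/existsP[v xv] | /existsPn x_ge0] := boolP [exists v, x v < 0]; last first.
  by apply: sumr_ge0 => v _; rewrite leNgt x_ge0.
(* A set of [P] containing [u] forbids the move from [u] to [v]. In the first case a zero sum over a
   member of [F] would become negative. The second case covers the separating sets of [X_sep]:
   avoiding it ensures that the sum over [X] does not increase. *)
pose P := [set A : {set V} | (v \notin A) &&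
                   ((A \in F) && (\sum_(u in A) x u == 0) || (~: A \in F))].
have P_le0 : \sum_(u in cover P) x u <= 0.
  apply: cover_le0 => [A | A B].
    rewrite inE => /andP[_ /orP[/andP[_ /eqP->]//|/xF]].
    by rewrite sumC oppr_ge0.
  (* Crossing [C] with [~: D] puts [C :|: ~: D], the complement of [D :\: C], in [F]. When the two
     do not cross, [C] and [D] are nested and [C :|: D] is one of them. *)
  have mixed C D : C \in F -> \sum_(u in C) x u = 0 -> ~: D \in F ->
      v \notin C -> v \notin D -> (C :|: D \in P) || (D :\: C \in P).
    move=> CF C0 DF vC vD; rewrite !inE (negPf vC) (negPf vD) andbF /=.
    have [|CD] := eqVneq (C :&: ~: D) set0.
      by move/eqP; rewrite -setDE setD_eq0 => /setUidPr ->; rewrite DF orbT.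
    have [/eqP|CD'] := eqVneq (C :|: ~: D) setT.
      rewrite -subTset -setCS setCT setCU setCK setIC -setDE subset0 setD_eq0.
      by move=> /setUidPl ->; rewrite CF C0 eqxx.
    have /andP[_] := F_cross _ _ CF DF CD CD'.
    by rewrite setCD setUC => ->; rewrite !orbT.
  rewrite !inE => /andP[vA /orP[/andP[AF /eqP A0]|AF]] /andP[vB /orP[/andP[BF /eqP B0]|BF]].
  - rewrite -setI_eq0 => AB; apply/orP; left; rewrite (negPf vA) (negPf vB) /=.
    have ABT : A :|: B != setT.
      by apply: contraTneq (in_setT v) => <-; rewrite inE negb_or vA.
    have /andP[IF UF] := F_cross _ _ AF BF AB ABT.
    have := xF _ IF; have := xF _ UF; have := sumUI A B; rewrite A0 B0 UF /=.
    by move=> *; apply/orP; left; apply/eqP; lia.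
  - move=> _; have := mixed A B AF A0 BF vA vB; rewrite !inE.
    by case/orP=> ->; rewrite ?orbT.
  - move=> _; have := mixed B A BF B0 AF vB vA; rewrite !inE [B :|: A]setUC orbC.
    by rewrite [(v \in B) || _]orbC; case/orP=> ->; rewrite ?orbT.
  - rewrite -setI_eq0 => AB; apply/orP; left; rewrite (negPf vA) (negPf vB) /=.
    have /andP[+ _] : (~: A :&: ~: B \in F) && (~: A :|: ~: B \in F).
      apply: F_cross => //; first by apply/set0Pn; exists v; rewrite !inE vA.
      by rewrite -setCI -setC0 (inj_eq (@setC_inj _)).
    by rewrite setCU => ->; rewrite orbT.
have vP : v \notin cover P.
  by apply/bigcupP => -[A]; rewrite inE => /andP[/negPf->].
(* As [x] has total zero, its sum outside [cover P] is nonnegative; the negative [x v] there must be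
   compensated. *)
have [u uP xu] : exists2 u, u \notin cover P & 0 < x u.
  apply/exists_inP; apply: contraT; rewrite negb_exists_in => /forall_inP x_le0.
  have : \sum_(i in ~: cover P) x i < 0.
    rewrite (bigD1 v) ?inE //=; apply: ltr_nwDl xv _; apply: sumr_le0 => i /andP[].
    by rewrite inE => /x_le0; rewrite -leNgt.
  by rewrite sumC oppr_lt0 ltNge P_le0.
pose y i : int := x i - (i == u)%:R + (i == v)%:R.
have sum_delta (A : {pred V}) z : \sum_(i in A) (i == z)%:R = (z \in A)%:R :> int.
  have [zA | zA] := boolP (z \in A).
    by rewrite (bigD1 z) //= eqxx big1 // => i /andP[_ /negPf->].
  by rewrite big1 // => i iA; case: eqP iA zA => // -> ->.
have sum_y (A : {pred V}) : \sum_(i in A) y i =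
    \sum_(i in A) x i - (u \in A)%:R + (v \in A)%:R.
  by rewrite !big_split /= sumrN !sum_delta.
have y_le_x : \sum_(i in X) y i <= \sum_(i in X) x i.
  rewrite sum_y; have [uX | uX] := boolP (u \in X); first by case: (v \in X); lia.
  have [vX | vX] := boolP (v \in X); last by lia.
  have [Z ZF /andP[uZ vZ]] := X_sep u v uX vX.
  case/bigcupP: uP; exists (~: Z); last by rewrite inE.
  by rewrite !inE setCK ZF vZ orbT.
apply: le_trans y_le_x; apply: IHn.
- rewrite -ltnS; apply: leq_trans xn; rewrite ltnS (bigD1 u) // [leqRHS](bigD1 u) //= -addSn.
  have uv : u != v by apply: contraTneq xu => ->; rewrite -leNgt ltW.
  apply: leq_add; first by rewrite /y eqxx (negPf uv); lia.
  apply: leq_sum => i /negPf iu; rewrite /y iu.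
  by have [-> | _] := eqVneq i v; lia.
- have -> : \sum_i y i = \sum_(i in predT) y i by apply: eq_bigl.
  by rewrite sum_y [X in X - _]xV !inE subrr.
- move=> Z ZF; rewrite sum_y; have := xF Z ZF.
  have [uZ | uZ] := boolP (u \in Z); last by case: (v \in Z); lia.
  have [vZ | vZ] := boolP (v \in Z); first by lia.
  rewrite le0r => /orP[Z0 | ]; last by lia.
  case/bigcupP: uP; exists Z => //.
  by rewrite !inE ZF vZ Z0.
Qed.

End Uncrossing.

(** Take [k] to be the entry of [t] at the first difference [j]. The prefixes contribute equally,
    the rest of the sorted [t] contributes zero, and the entry of [s] at [j] contributes a positive
    amount. *)
Lemma majorized_not_lex_smaller (s t : seq nat) :
  sorted geq t ->
  (forall k, \sum_(i <- s) (i - k) <= \sum_(i <- t) (i - k)) ->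
  ~ lex_smaller t s.
Proof.
move=> st maj [j [jt js lt_j eq_i]]; have := maj (nth 0 t j).
rewrite -{1}(cat_take_drop j s) -{2}(cat_take_drop j t) !big_cat /=.
have -> : take j s = take j t.
  apply: (@eq_from_nth _ 0) => [|i]; first by rewrite !size_take jt js.
  by rewrite size_take js => ij; rewrite !nth_take // eq_i.
rewrite (drop_nth 0 js) big_cons.
rewrite [X in _ <= _ + X]big1_seq; first by lia.
move=> i /andP[_ /(nthP 0)[m +] <-]; rewrite size_drop nth_drop => mt.
apply/eqP; rewrite subn_eq0.
apply: (sorted_leq_nth _ _ _ st) => //.
- by move=> a b c /= ba cb; apply: leq_trans cb ba.
- by move=> a /=.
- by rewrite inE -ltn_subRL.
- exact: leq_addr.
Qed.

(** * Majorization by any other strongly connected orientation *)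

Section Optimality.

Variables (V : finType) (e : rel V).
Hypothesis e_sym : symmetric e.
Variables L L' : {set V * V}.
Hypotheses (L_sc : sc_orientation e L) (L'_sc : sc_orientation e L').
Hypothesis L_stuck : ~ exists u v p, strongly_reversible L u v p.

Let tight : {set {set V}} := [set Z | incut L Z == 1].

Lemma tight_proper Z : Z \in tight -> (Z != set0) && (Z != setT).
Proof.
rewrite inE => /eqP Z1; have /incut_gt0P[a _ /andP[a1 a2]] : 0 < incut L Z by rewrite Z1.
by apply/andP; split; [apply: contraTneq a2 | apply: contraNneq a1] => ->; rewrite inE.
Qed.

Lemma tight_crossing Z1 Z2 :
  Z1 \in tight -> Z2 \in tight -> Z1 :&: Z2 != set0 -> Z1 :|: Z2 != setT ->
  (Z1 :&: Z2 \in tight) && (Z1 :|: Z2 \in tight).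
Proof.
move=> T1 T2 I0 UT; have := incut_submod L Z1 Z2.
have cut := (strongly_connectedP L).1 L_sc.2.
have IT : Z1 :&: Z2 != setT.
  apply: contraNneq UT => IT; rewrite -subTset -IT.
  exact: subset_trans (subsetIl _ _) (subsetUl _ _).
have U0 : Z1 :|: Z2 != set0.
  apply: contraNneq I0 => U0; rewrite -subset0 -U0.
  exact: subset_trans (subsetIl _ _) (subsetUl _ _).
have := cut _ I0 IT; have := cut _ U0 UT; move: T1 T2; rewrite !inE => /eqP-> /eqP->.
by move=> *; apply/andP; split; apply/eqP; lia.
Qed.

(** A cut separating [u] from [v] is nonempty by strong connectivity and not tight, so it has two
    arcs. Menger's theorem then makes any path from [u] to [v] strongly reversible if the indegrees
    differ by more than one. *)
Lemma stuck_indegree u v :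
  (forall Z, Z \in tight -> v \in Z -> u \in Z) -> indegree L v <= (indegree L u).+1.
Proof.
move=> Tuv; have [-> // | uv] := eqVneq u v.
have uv2 : two_reaches L u v.
  apply: (two_reaches_of_incut e_sym L_sc.1) => Z uZ vZ.
  have Z_gt0 : 0 < incut L Z by apply: (connect_incut _ _ _ (L_sc.2 u v)).
  rewrite ltn_neqAle eq_sym Z_gt0 andbT; apply: contraNN uZ => Z1.
  by apply: Tuv vZ; rewrite inE.
rewrite leqNgt; apply/negP => d_uv; apply: L_stuck.
case: (uv2) => [/eqP | [p [q [Lp _ _]]]]; first by rewrite (negPf uv).
by exists u, v, p; split=> //; lia.
Qed.

(** The crossing family lemma is applied to the difference of the indegrees. Its total is zero
    because both orientations have as many arcs as there are edges; on a tight set it is nonnegative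
    because the cut of [L] is 1 and that of [L'] at least 1. *)
Lemma tight_sum_indegree (X : {set V}) :
  (forall u v, u \notin X -> v \in X ->
     exists2 Z, Z \in tight & (u \notin Z) && (v \in Z)) ->
  \sum_(v in X) indegree L v <= \sum_(v in X) indegree L' v.
Proof.
move=> X_sep; pose x v : int := ((indegree L' v)%:Z - (indegree L v)%:Z)%R.
have xE (A : {pred V}) : (\sum_(v in A) x v)%R =
    ((\sum_(v in A) indegree L' v)%:Z - (\sum_(v in A) indegree L v)%:Z)%R.
  by rewrite big_split /= sumrN -!(big_morph Posz PoszD (erefl _)).
suff : (0 <= \sum_(v in X) x v)%R by rewrite xE; lia.
apply: (crossing_family_ge0 tight_crossing X_sep).
  have cutT M : incut M [set: V] = 0.
    by rewrite /incut big1 // => a _; rewrite /enters inE.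
  have := sum_indegree e_sym setT L_sc.1; have := sum_indegree e_sym setT L'_sc.1.
  have -> : (\sum_v x v = \sum_(v in [set: V]) x v)%R by apply: eq_bigl => v; rewrite inE.
  by rewrite xE !cutT; lia.
move=> Z TZ; have /andP[Z0 ZT] := tight_proper TZ.
have := sum_indegree e_sym Z L_sc.1; have := sum_indegree e_sym Z L'_sc.1.
have := (strongly_connectedP L').1 L'_sc.2 Z Z0 ZT.
by move: TZ; rewrite inE xE => /eqP->; lia.
Qed.

Lemma stuck_majorized k :
  \sum_v (indegree L v - k) <= \sum_v (indegree L' v - k).
Proof.
(* Two-reaching appears in its dual form: no tight set contains [v] and misses [u]. A tight set that
   contains [v] and misses some vertex therefore contains every [u] that two-reaches [v], which
   yields [X_sep]. *)
pose X := [set u | [exists (v | k < indegree L v),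
                    forall (Z | (Z \in tight) && (v \in Z)), u \in Z]].
have XP u : reflect (exists2 v, k < indegree L v &
                       forall Z, Z \in tight -> v \in Z -> u \in Z) (u \in X).
  rewrite inE; apply: (iffP exists_inP) => -[v kv uv]; exists v => //.
    by move=> Z TZ vZ; apply: (forall_inP uv); rewrite TZ vZ.
  by apply/forall_inP => Z /andP[]; apply: uv.
have X_sep u v : u \notin X -> v \in X ->
    exists2 Z, Z \in tight & (u \notin Z) && (v \in Z).
  rewrite inE negb_exists_in => /forall_inP uX /XP[h kh vh].
  have := uX h kh; rewrite negb_forall_in => /exists_inP[Z /andP[TZ hZ] uZ].
  by exists Z; rewrite ?uZ ?vh.
have Xk u : u \in X -> k <= indegree L u.
  by case/XP=> v kv /stuck_indegree; lia.
have Xk' u : u \notin X -> indegree L u <= k.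
  by apply: contraNleq => ku; apply/XP; exists u.
rewrite (bigID [in X]) /= [X in _ + X]big1 ?addn0; last first.
  by move=> u /Xk' uk; apply/eqP; rewrite subn_eq0.
rewrite [leqRHS](bigID [in X]) /=; apply: leq_trans (leq_addr _ _).
(* On [X] the subtraction is exact for [L], since the indegrees are at least [k]; for [L']
   truncation can only increase the right-hand side. *)
rewrite -(leq_add2r (\sum_(v in X) k)) -!big_split /=.
apply: leq_trans (leq_trans _ (tight_sum_indegree X_sep)) _.
  by apply: leq_sum => v /Xk vk; rewrite subnK.
by apply: leq_sum => v _; lia.
Qed.

End Optimality.

Lemma sum_indegree_seq (V : finType) (L : {set V * V}) k :
  \sum_(i <- indegree_seq L) (i - k) = \sum_v (indegree L v - k).
Proof.
by rewrite (perm_big _ (permEl (perm_sort _ _))) big_map big_enum.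
Qed.

Theorem theorem1 (V : finType) (e : rel V)
  (e_sym : symmetric e) (e_irr : irreflexive e)
  (G_sc : exists L0 : {set V * V}, sc_orientation e L0)
  (L : {set V * V}) (L_out : sc_path_reversal_output e L) :
  sc_orientation e L /\
  ~ (exists L' : {set V * V},
       sc_orientation e L' /\
       lex_smaller (indegree_seq L') (indegree_seq L)).
Proof.
case: L_out => L0 [L0_sc run stuck].
have L_sc : sc_orientation e L.
  elim: run L0_sc {stuck} => [A B AB A_sc | // | A B C _ IH1 _ IH2 /IH1/IH2 //].
  exact: reversal_step_sc A_sc AB.
split=> // -[L' [L'_sc]]; apply: majorized_not_lex_smaller => [|k].
  by apply: sort_sorted => a b; apply: leq_total.
by rewrite !sum_indegree_seq; apply: (stuck_majorized e_sym L_sc L'_sc stuck).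
Qed.
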